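(* Suppose that the matrix $Z^TQZ$ is indefinite. For $\alpha_z\ge0$, let $\mu_{\mathrm{EIGZ}}(\alpha_z)$ be the optimal objective function value of $$\min_{x\in\mathcal X}\ x^T(Q+\alpha_zI_n)x+\big(q-\alpha_z(l+u)\big)^Tx+\alpha_z\,l^Tu,$$ and let $\mu_{\mathrm{SDP\_EIGZ}}$ be the optimal objective function value of $$\min_{x\in\mathcal X,\;X\in\mathbb S^n}\ \langle Q,X\rangle+q^Tx\quad\text{s.t.}\quad X-xx^T\succcurlyeq0,\quad \langle I_n,X\rangle-(l+u)^Tx+l^Tu\le0,\quad \langle A^TA,X\rangle-(2A^Tb)^Tx+b^Tb=0.$$ Then the following hold: (i) If $\alpha_z\ge-\lambda_{\min}(Z^TQZ)$, then $\mu_{\mathrm{EIGZ}}(\alpha_z)\le\mu_{\mathrm{SDP\_EIGZ}}$. (ii) If $\alpha_z=-\lambda_{\min}(Z^TQZ)$, then $\mu_{\mathrm{EIGZ}}(\alpha_z)=\mu_{\mathrm{SDP\_EIGZ}}$.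
   Context: $Q\in\mathbb R^{n\times n}$ is symmetric, $q\in\mathbb R^n$, and $\mathcal X=\{x\in\mathbb R^n: Ax=b,\ Cx\le d,\ l\le x\le u\}$ with $A\in\mathbb R^{m\times n}$, $b\in\mathbb R^m$, $C\in\mathbb R^{p\times n}$, $d\in\mathbb R^p$, and finite bounds $-\infty<l_i<u_i<\infty$ for all $i$. $Z$ is a matrix whose columns form an orthonormal basis of the nullspace of $A$. $\mathbb S^n$ is the set of real symmetric $n\times n$ matrices, $\langle M,P\rangle=\sum_{i,j}M_{ij}P_{ij}$, $M\succcurlyeq0$ means positive semidefinite, $I_n$ is the identity, and $\lambda_{\min}(M)$ is the smallest eigenvalue of a symmetric matrix $M$. *)

(* Defs.v *)
(* MathComp / MathComp-Analysis; vectors are column vectors. *)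
From mathcomp Require Export all_boot all_order all_algebra.
From mathcomp Require Export all_classical all_reals all_analysis.

Set Implicit Arguments.
Unset Strict Implicit.
Unset Printing Implicit Defensive.

Import Order.TTheory GRing.Theory Num.Theory.

Local Open Scope classical_set_scope.
Local Open Scope ring_scope.

Definition dotv (R : realType) (n : nat) (x y : 'cV[R]_n) : R :=
  (x^T *m y) 0 0.

Definition quadform (R : realType) (n : nat) (M : 'M[R]_n) (x : 'cV[R]_n) : R :=
  (x^T *m M *m x) 0 0.

Definition mxinner (R : realType) (n : nat) (M P : 'M[R]_n) : R :=
  \sum_i \sum_j M i j * P i j.

Definition psdmx (R : realType) (n : nat) (M : 'M[R]_n) : Prop :=
  M \is symmetricmx /\ forall x : 'cV[R]_n, 0 <= quadform M x.

Definition indefinitemx (R : realType) (n : nat) (M : 'M[R]_n) : Prop :=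
  [/\ M \is symmetricmx, ~ psdmx M & ~ psdmx (- M)].

(* For symmetric M of positive size the set of eigenvalues is finite and
   nonempty, so this infimum is a minimum. *)
Definition lambda_min (R : realType) (n : nat) (M : 'M[R]_n) : R :=
  inf [set a : R | eigenvalue M a].

(* kermx works on rows: the row space of kermx A^T is {x^T | A x = 0}. *)
Definition orthonormal_nullspace_basis (R : realType) (m n k : nat)
    (A : 'M[R]_(m, n)) (Z : 'M[R]_(n, k)) : Prop :=
  Z^T *m Z = 1%:M /\ (Z^T == kermx A^T)%MS.

Definition polyX (R : realType) (m n p : nat)
    (A : 'M[R]_(m, n)) (b : 'cV[R]_m) (C : 'M[R]_(p, n)) (d : 'cV[R]_p)
    (l u : 'cV[R]_n) : set 'cV[R]_n :=
  [set x | [/\ A *m x = b,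
               forall i, (C *m x) i 0 <= d i 0
             & forall i, l i 0 <= x i 0 <= u i 0]].

Definition eigz_obj (R : realType) (n : nat) (Q : 'M[R]_n) (q l u : 'cV[R]_n)
    (alpha : R) (x : 'cV[R]_n) : R :=
  quadform (Q + alpha *: 1%:M) x + dotv (q - alpha *: (l + u)) x
    + alpha * dotv l u.

(* Optimal values are infima in the extended reals: +oo if infeasible. *)
Definition mu_EIGZ (R : realType) (m n p : nat)
    (Q : 'M[R]_n) (q : 'cV[R]_n)
    (A : 'M[R]_(m, n)) (b : 'cV[R]_m) (C : 'M[R]_(p, n)) (d : 'cV[R]_p)
    (l u : 'cV[R]_n) (alpha : R) : \bar R :=
  ereal_inf [set (eigz_obj Q q l u alpha x)%:E | x in polyX A b C d l u].

Definition sdp_eigz_feasible (R : realType) (m n p : nat)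
    (A : 'M[R]_(m, n)) (b : 'cV[R]_m) (C : 'M[R]_(p, n)) (d : 'cV[R]_p)
    (l u : 'cV[R]_n) : set ('cV[R]_n * 'M[R]_n) :=
  [set xX | let: (x, X) := xX in
    [/\ polyX A b C d l u x,
        X \is symmetricmx,
        psdmx (X - x *m x^T),
        mxinner 1%:M X - dotv (l + u) x + dotv l u <= 0
      & mxinner (A^T *m A) X - dotv (2 *: (A^T *m b)) x + dotv b b = 0]].

Definition mu_SDP_EIGZ (R : realType) (m n p : nat)
    (Q : 'M[R]_n) (q : 'cV[R]_n)
    (A : 'M[R]_(m, n)) (b : 'cV[R]_m) (C : 'M[R]_(p, n)) (d : 'cV[R]_p)
    (l u : 'cV[R]_n) : \bar R :=
  ereal_inf [set (mxinner Q xX.2 + dotv q xX.1)%:E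
            | xX in sdp_eigz_feasible A b C d l u].

(* Main.v *)
Require Import Defs.
From mathcomp Require Import ring lra.
Set Implicit Arguments.
Unset Strict Implicit.
Unset Printing Implicit Defensive.
Import Order.TTheory GRing.Theory Num.Theory.
Local Open Scope ring_scope.

(** Write g(x) = |x|^2 - (l + u)^T x + l^T u, the sum of the products
    (x_i - l_i)(x_i - u_i), so that g <= 0 on the box and the objective of EIGZ
    is x^T Q x + q^T x + alpha g(x) ([eigz_objE]).  Write a point of the
    semidefinite relaxation as (x, x x^T + P) with P positive semidefinite.
    Since A x = b, its last two constraints then read g(x) + tr P <= 0 and
    <A^T A, P> = 0 ([boxgap_lift], [gram_lift]), and its objective is
    x^T Q x + q^T x + <Q, P>.  So the two problems differ only in that
    alpha g(x) is replaced by <Q, P>.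

    The constraint <A^T A, P> = tr (A P A^T) = 0 forces P A^T = 0
    ([psdmx_gram_orthogonal]): P lives on the nullspace of A, that is,
    P = Z S Z^T with S = Z^T P Z positive semidefinite
    ([nullspace_compression]).  Hence
    <Q, P> + alpha tr P = <Z^T Q Z + alpha I, S>, which is nonnegative as soon
    as alpha >= - lambda_min (Z^T Q Z), because the inner product of two positive
    semidefinite matrices is nonnegative ([mxinner_psdmx_ge0]).  Together with
    tr P <= - g(x) this gives <Q, P> >= alpha g(x) ([eigz_le_sdp]).

    For equality at alpha = - lambda_min, spend the whole slack - g(x) >= 0 on an
    eigenvector w of the smallest eigenvalue: P = - g(x) (Z w)(Z w)^T / |w|^2
    has trace - g(x), is killed by A, and <Q, P> = - lambda_min g(x)
    ([eigz_attained_sdp]).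

    That lambda_min is an eigenvalue bounding the Rayleigh quotient from below
    ([lambda_minP]) is proved without compactness or the spectral theorem, from
    the Cauchy-Schwarz inequality for semidefinite forms. *)

(** * Dot products, quadratic forms and the trace inner product *)

Section InnerProducts.
Variable R : realType.

Lemma symmetricmxP n (M : 'M[R]_n) : reflect (M^T = M) (M \is symmetricmx).
Proof.
rewrite is_hermitianmxE expr0 scale1r map_mx_id //.
by rewrite eq_sym; exact: eqP.
Qed.

Lemma dotvE n (x y : 'cV[R]_n) : dotv x y = \sum_i x i 0 * y i 0.
Proof. by rewrite /dotv mxE; apply: eq_bigr => i _; rewrite mxE. Qed.

Lemma dotvC n (x y : 'cV[R]_n) : dotv x y = dotv y x.
Proof. by rewrite !dotvE; apply: eq_bigr => i _; rewrite mulrC. Qed.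

Lemma dotvDl n (x y z : 'cV[R]_n) : dotv (x + y) z = dotv x z + dotv y z.
Proof. by rewrite /dotv linearD mulmxDl mxE. Qed.

Lemma dotvDr n (x y z : 'cV[R]_n) : dotv z (x + y) = dotv z x + dotv z y.
Proof. by rewrite /dotv mulmxDr mxE. Qed.

Lemma dotvZl n a (x z : 'cV[R]_n) : dotv (a *: x) z = a * dotv x z.
Proof. by rewrite /dotv linearZ -scalemxAl mxE. Qed.

Lemma dotvZr n a (x z : 'cV[R]_n) : dotv z (a *: x) = a * dotv z x.
Proof. by rewrite /dotv -scalemxAr mxE. Qed.

Lemma dotvNl n (x z : 'cV[R]_n) : dotv (- x) z = - dotv x z.
Proof. by rewrite -scaleN1r dotvZl mulN1r. Qed.

Lemma dotvNr n (x z : 'cV[R]_n) : dotv z (- x) = - dotv z x.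
Proof. by rewrite -scaleN1r dotvZr mulN1r. Qed.

Lemma dotv0r n (z : 'cV[R]_n) : dotv z 0 = 0.
Proof. by rewrite /dotv mulmx0 mxE. Qed.

Lemma quadform0 n (M : 'M[R]_n) : quadform M 0 = 0.
Proof. by rewrite /quadform mulmx0 mxE. Qed.

Lemma dotv_mulmxr m n (M : 'M[R]_(m, n)) x y :
  dotv x (M *m y) = dotv (M^T *m x) y.
Proof. by rewrite /dotv trmx_mul trmxK mulmxA. Qed.

Lemma dotvv_ge0 n (x : 'cV[R]_n) : 0 <= dotv x x.
Proof. by rewrite dotvE; apply: sumr_ge0 => i _; rewrite -expr2 sqr_ge0. Qed.

Lemma dotvv_eq0 n (x : 'cV[R]_n) : (dotv x x == 0) = (x == 0).
Proof.
apply/eqP/eqP => [|->]; last by rewrite dotv0r.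
rewrite dotvE => /eqP; rewrite psumr_eq0 => [/allP x0|i _]; last first.
  by rewrite -expr2 sqr_ge0.
apply/matrixP => i j; rewrite (ord1 j) mxE.
by have /= := x0 i (mem_index_enum i); rewrite -expr2 sqrf_eq0 => /eqP.
Qed.

Lemma quadformE n (M : 'M[R]_n) x : quadform M x = dotv x (M *m x).
Proof. by rewrite /quadform /dotv mulmxA. Qed.

Lemma quadformD n (M N : 'M[R]_n) x :
  quadform (M + N) x = quadform M x + quadform N x.
Proof. by rewrite !quadformE mulmxDl dotvDr. Qed.

Lemma quadformN n (M : 'M[R]_n) x : quadform (- M) x = - quadform M x.
Proof. by rewrite !quadformE mulNmx dotvNr. Qed.

Lemma quadformZ n a (M : 'M[R]_n) x : quadform (a *: M) x = a * quadform M x.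
Proof. by rewrite !quadformE -scalemxAl dotvZr. Qed.

Lemma quadform_scalar n a (x : 'cV[R]_n) : quadform a%:M x = a * dotv x x.
Proof. by rewrite quadformE mul_scalar_mx dotvZr. Qed.

Lemma quadform_dyad n (y z x : 'cV[R]_n) :
  quadform (y *m z^T) x = dotv x y * dotv z x.
Proof.
by rewrite /quadform mulmxA -mulmxA mxE big_ord1.
Qed.

Lemma quadform_conj m n (M : 'M[R]_m) (B : 'M[R]_(m, n)) x :
  quadform (B^T *m M *m B) x = quadform M (B *m x).
Proof. by rewrite !quadformE -!mulmxA dotv_mulmxr trmxK. Qed.

Lemma quadform_delta n (M : 'M[R]_n) i : quadform M (delta_mx i 0) = M i i.
Proof. by rewrite /quadform trmx_delta -mulmxA -colE -rowE !mxE. Qed.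

Lemma mxinnerE n (M P : 'M[R]_n) : mxinner M P = \tr (M^T *m P).
Proof.
rewrite /mxinner exchange_big; apply: eq_bigr => j _.
by rewrite mxE; apply: eq_bigr => i _; rewrite mxE.
Qed.

Lemma mxinnerDr n (M P S : 'M[R]_n) :
  mxinner M (P + S) = mxinner M P + mxinner M S.
Proof. by rewrite !mxinnerE mulmxDr mxtraceD. Qed.

Lemma mxinnerZr n a (M P : 'M[R]_n) : mxinner M (a *: P) = a * mxinner M P.
Proof. by rewrite !mxinnerE -scalemxAr mxtraceZ. Qed.

Lemma mxinner_dyad n (M : 'M[R]_n) x : mxinner M (x *m x^T) = quadform M x.
Proof.
rewrite mxinnerE mulmxA mxtrace_mulC trace_mx11 -[LHS]/(dotv _ _).
by rewrite dotv_mulmxr trmxK dotvC -quadformE.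
Qed.

Lemma mxinner1 n (P : 'M[R]_n) : mxinner 1%:M P = \tr P.
Proof. by rewrite mxinnerE trmx1 mul1mx. Qed.

Lemma mxinnerDl n (M N P : 'M[R]_n) :
  mxinner (M + N) P = mxinner M P + mxinner N P.
Proof. by rewrite !mxinnerE linearD mulmxDl mxtraceD. Qed.

Lemma mxinner_scalar n a (P : 'M[R]_n) : mxinner a%:M P = a * \tr P.
Proof. by rewrite mxinnerE tr_scalar_mx mul_scalar_mx mxtraceZ. Qed.

(** Adjointness of the congruence by [B] and the congruence by its transpose:
    cyclicity of the trace. *)
Lemma mxinner_conj m n (M : 'M[R]_m) (B : 'M[R]_(m, n)) P :
  mxinner M (B *m P *m B^T) = mxinner (B^T *m M *m B) P.
Proof.
rewrite !mxinnerE !trmx_mul trmxK mxtrace_mulC -!mulmxA.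
rewrite mxtrace_mulC -!mulmxA.
by rewrite mxtrace_mulC -!mulmxA; congr (\tr _); rewrite !mulmxA.
Qed.

End InnerProducts.

(** * Positive semidefinite matrices *)

Section PositiveSemidefinite.
Variable R : realType.

Lemma psdmx_sym n (P : 'M[R]_n) : psdmx P -> P^T = P.
Proof. by case=> /symmetricmxP. Qed.

Lemma psdmx_intro n (P : 'M[R]_n) :
  P^T = P -> (forall x, 0 <= quadform P x) -> psdmx P.
Proof. by move=> Pt P0; split=> //; apply/symmetricmxP. Qed.

Lemma psdmx_dyad n (x : 'cV[R]_n) : psdmx (x *m x^T).
Proof.
apply: psdmx_intro => [|y]; first by rewrite trmx_mul trmxK.
by rewrite quadform_dyad dotvC -expr2 sqr_ge0.
Qed.

Lemma psdmxZ n a (P : 'M[R]_n) : 0 <= a -> psdmx P -> psdmx (a *: P).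
Proof.
move=> a0 psdP; apply: psdmx_intro => [|x].
  by rewrite linearZ /= psdmx_sym.
by rewrite quadformZ mulr_ge0 //; case: psdP.
Qed.

Lemma psdmx_conj m n (P : 'M[R]_m) (B : 'M[R]_(m, n)) :
  psdmx P -> psdmx (B^T *m P *m B).
Proof.
move=> psdP; apply: psdmx_intro => [|x].
  by rewrite !trmx_mul trmxK psdmx_sym // mulmxA.
by rewrite quadform_conj; case: psdP.
Qed.

(** The quadratic form is nonnegative along the plane spanned by [x] and [y],
    so its discriminant there has a sign. *)
Lemma psdmx_cauchy_schwarz n (P : 'M[R]_n) x y : psdmx P ->
  dotv x (P *m y) ^+ 2 <= quadform P x * quadform P y.
Proof.
move=> psdP; have [_ P0] := psdP.
have symP : dotv y (P *m x) = dotv x (P *m y).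
  by rewrite dotv_mulmxr psdmx_sym // dotvC.
have expand s t : quadform P (s *: x - t *: y) =
    s ^+ 2 * quadform P x - 2 * s * t * dotv x (P *m y)
    + t ^+ 2 * quadform P y.
  rewrite !quadformE mulmxBr -!scalemxAr !(dotvDl, dotvDr, dotvNl, dotvNr).
  by rewrite !(dotvZl, dotvZr) symP; ring.
set B := dotv x _ in expand *.
have := P0 x; have := P0 y; set X := quadform P x; set Y := quadform P y.
rewrite -/X -/Y in expand => Y0 X0.
have [Y_eq0|Y_neq0] := eqVneq Y 0.
  (* The form is now affine along the line B x - t y, equal to
     B^2 (X - 2 t); it is negative at t = (X + 1) / 2 unless B = 0. *)
  have := P0 (B *: x - (X + 1) / 2 *: y); rewrite expand Y_eq0.
  by nra.
have := P0 (Y *: x - B *: y); rewrite expand => H.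
have {Y_neq0} Y_gt0 : 0 < Y by rewrite lt_neqAle eq_sym Y_neq0.
rewrite -subr_ge0 -(pmulr_rge0 _ Y_gt0).
by apply: le_trans H _; rewrite le_eqVlt; apply/orP; left; apply/eqP; ring.
Qed.

Lemma psdmx_isotropic n (P : 'M[R]_n) x :
  psdmx P -> quadform P x = 0 -> P *m x = 0.
Proof.
move=> psdP Px0; have := psdmx_cauchy_schwarz (P *m x) x psdP.
rewrite Px0 mulr0 => le0; apply/eqP; rewrite -dotvv_eq0 -sqrf_eq0.
by rewrite eq_le le0 sqr_ge0.
Qed.

(** Deflation: subtracting from [P] the dyad of its column [c = P e_i], divided
    by [P i i], leaves a positive semidefinite matrix (this is the
    Cauchy-Schwarz inequality against [e_i]) with one more vanishing diagonal
    entry.  Each dyad removed contributes [quadform M c / P i i >= 0], and a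
    positive semidefinite matrix with zero diagonal is zero. *)
Lemma mxinner_psdmx_ge0 n (M P : 'M[R]_n) :
  psdmx M -> psdmx P -> 0 <= mxinner M P.
Proof.
move=> psdM; move sE: #|[pred i | P i i != 0]| => s.
elim/ltn_ind: s P sE => s IHs P sE psdP.
have [_ M0] := psdM; have [_ P0] := psdP.
have [/existsP[i Pii_neq0]|/existsPn diag0] :=
  boolP [exists i, P i i != 0].
  have Pii_gt0 : 0 < P i i.
    by rewrite lt_neqAle eq_sym Pii_neq0 -quadform_delta P0.
  pose c := P *m delta_mx i 0 : 'cV[R]_n.
  pose P' := P - (P i i)^-1 *: (c *m c^T).
  have PE : P = P' + (P i i)^-1 *: (c *m c^T) by rewrite /P' subrK.
  have qP' x : quadform P' x = quadform P x - (P i i)^-1 * dotv x c ^+ 2.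
    by rewrite quadformD quadformN quadformZ quadform_dyad (dotvC c) expr2.
  have psdP' : psdmx P'.
    apply: psdmx_intro => [|x].
      by rewrite /P' linearB linearZ /= trmx_mul trmxK (psdmx_sym psdP).
    rewrite qP' subr_ge0 mulrC ler_pdivrMr //.
    by rewrite -(quadform_delta P); exact: psdmx_cauchy_schwarz.
  rewrite PE mxinnerDr mxinnerZr mxinner_dyad addr_ge0 //; last first.
    by rewrite mulr_ge0 // invr_ge0 ltW.
  apply: (IHs _ _ P' erefl psdP'); rewrite -sE.
  apply: proper_card; apply/properP; split; last first.
    exists i; rewrite inE //= negbK -quadform_delta qP' quadform_delta.
    rewrite /c -quadformE quadform_delta expr2 mulrA mulVf // mul1r subrr //.
  (* Zero diagonal entries stay zero: P e_j = 0 kills the coordinate c_j. *)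
  apply/fintype.subsetP => j; rewrite !inE; apply: contra => /eqP Pjj0.
  have Pj0 : P *m delta_mx j 0 = 0 :> 'cV_n.
    by apply: psdmx_isotropic => //; rewrite quadform_delta.
  rewrite -quadform_delta qP' quadform_delta Pjj0.
  rewrite /c dotv_mulmxr psdmx_sym // Pj0 dotvC dotv0r.
  by rewrite expr0n mulr0 subrr.
suff -> : P = 0 by rewrite mxinnerE mulmx0 mxtrace0.
apply/matrixP => i j; rewrite mxE.
have : P *m delta_mx j 0 = 0 :> 'cV_n.
  apply: psdmx_isotropic => //; rewrite quadform_delta.
  by apply/eqP; rewrite -[_ == _]negbK.
by rewrite -colE => /matrixP/(_ i 0); rewrite !mxE.
Qed.

(** The hypothesis says that the positive semidefinite matrix A P A^T has trace
    zero; its diagonal entries are the values of the form [P] at the rows of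
    [A], which are therefore isotropic vectors of [P]. *)
Lemma psdmx_gram_orthogonal m n (A : 'M[R]_(m, n)) (P : 'M[R]_n) :
  psdmx P -> mxinner (A^T *m A) P = 0 -> P *m A^T = 0.
Proof.
move=> psdP; rewrite -[X in X *m A]mulmx1 -mxinner_conj mxinner1.
have psdAP : psdmx (A *m P *m A^T).
  by rewrite -{1}[A]trmxK; exact: psdmx_conj.
have diagE i : (A *m P *m A^T) i i = quadform P (A^T *m delta_mx i 0).
  by rewrite -quadform_delta -{1}[A]trmxK quadform_conj.
move=> /eqP; rewrite psumr_eq0 => [/allP tr0|i _]; last first.
  by rewrite diagE; case: psdP.
apply/matrixP => i j; rewrite [RHS]mxE.
have /= := tr0 j (mem_index_enum j); rewrite diagE => /eqP.
move=> /(psdmx_isotropic psdP); rewrite mulmxA -colE.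
by move=> /matrixP/(_ i 0); rewrite !mxE.
Qed.

End PositiveSemidefinite.

(** * The smallest eigenvalue of a symmetric matrix *)

Section SmallestEigenvalue.
Variable R : realType.

Lemma quadform_bounded n (M : 'M[R]_n) :
  exists2 K, 0 < K & forall x, quadform M x <= K * dotv x x.
Proof.
exists (1 + \sum_i \sum_j `|M i j|) => [|x].
  by rewrite ltr_pwDl // sumr_ge0 // => i _; rewrite sumr_ge0.
apply: (@le_trans _ _ ((\sum_i \sum_j `|M i j|) * dotv x x)); last first.
  by rewrite mulrDl mul1r lerDr dotvv_ge0.
have coord i : x i 0 ^+ 2 <= dotv x x.
  rewrite dotvE (bigD1 i) //= -expr2 lerDl sumr_ge0 // => j _.
  by rewrite -expr2 sqr_ge0.
rewrite -mxinner_dyad mulr_suml /mxinner; apply: ler_sum => i _.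
rewrite mulr_suml; apply: ler_sum => j _.
apply: le_trans (ler_norm _) _; rewrite normrM ler_wpM2l //.
rewrite mxE big_ord1 mxE ler_norml.
have := coord i; have := coord j.
set a := x i 0; set b := x j 0 => Hb Ha.
have := sqr_ge0 (a - b); have := sqr_ge0 (a + b).
by rewrite !expr2 in Ha Hb * => Hp Hm; apply/andP; split; nra.
Qed.

(** Cauchy-Schwarz for [N] at [x] and [invmx N *m x] gives
    |x|^4 <= (x^T N x)(x^T N^-1 x), and the last factor is at most K |x|^2. *)
Lemma psdmx_unit_coercive n (N : 'M[R]_n) : psdmx N -> N \in unitmx ->
  exists2 e, 0 < e & psdmx (N - e%:M).
Proof.
move=> psdN unitN; have [_ N0] := psdN.
have [K K_gt0 HK] := quadform_bounded (invmx N).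
exists K^-1; first by rewrite invr_gt0.
apply: psdmx_intro => [|x].
  by rewrite linearB /= tr_scalar_mx psdmx_sym.
rewrite quadformD quadformN quadform_scalar subr_ge0 mulrC ler_pdivrMr //.
have [->|x_neq0] := eqVneq x 0; first by rewrite quadform0 dotv0r mul0r.
have xx_gt0 : 0 < dotv x x.
  by rewrite lt_neqAle dotvv_ge0 eq_sym dotvv_eq0 x_neq0.
rewrite -(ler_pM2l xx_gt0) -expr2.
have := psdmx_cauchy_schwarz x (invmx N *m x) psdN.
rewrite (quadformE N (invmx N *m x)) mulKVmx // dotvC -quadformE => CS.
apply: le_trans CS _; apply: le_trans (ler_wpM2l (N0 x) (HK x)) _.
by rewrite le_eqVlt; apply/orP; left; apply/eqP; ring.
Qed.

(** Let mu be the supremum of the c such that M - c I is positive semidefinite.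
    This property passes to the limit, so it holds of mu; and M - mu I is
    singular, for otherwise coercivity would leave room above mu.  So mu is an
    eigenvalue, and it bounds every eigenvalue from below because it bounds the
    Rayleigh quotient. *)
Lemma lambda_minP n (M : 'M[R]_n) : (0 < n)%N -> M^T = M ->
  psdmx (M - (lambda_min M)%:M) /\ eigenvalue M (lambda_min M).
Proof.
move=> n_gt0 symM.
have symB c : (M - c%:M)^T = M - c%:M by rewrite linearB /= tr_scalar_mx symM.
have qB c x : quadform (M - c%:M) x = quadform M x - c * dotv x x.
  by rewrite quadformD quadformN quadform_scalar.
pose S : set R := [set c | psdmx (M - c%:M)]%classic.
have boundS c x : S c -> c * dotv x x <= quadform M x.
  by case=> _ /(_ x); rewrite qB subr_ge0.
pose e : 'cV[R]_n := delta_mx (Ordinal n_gt0) 0.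
have ee : dotv e e = 1.
  by rewrite -[LHS]mul1r -quadform_scalar quadform_delta mxE eqxx.
have S_neq0 : (S !=set0)%classic.
  have [K K_gt0 HK] := quadform_bounded (- M).
  exists (- K); apply: psdmx_intro => // x.
  by rewrite qB; have := HK x; rewrite quadformN; lra.
have S_ub : has_ubound S.
  by exists (quadform M e) => c /(boundS _ e); rewrite ee mulr1.
pose mu := sup S.
have psd_mu : psdmx (M - mu%:M).
  apply: psdmx_intro => // x; rewrite qB subr_ge0.
  have [->|x_neq0] := eqVneq x 0; first by rewrite quadform0 dotv0r mulr0.
  have xx_gt0 : 0 < dotv x x.
    by rewrite lt_neqAle dotvv_ge0 eq_sym dotvv_eq0 x_neq0.
  rewrite -ler_pdivlMr //; apply: ge_sup => // c /boundS Sc.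
  by rewrite ler_pdivlMr.
have eig_mu : eigenvalue M mu.
  rewrite /eigenvalue /eigenspace kermx_eq0 row_free_unit; apply/negP => unitB.
  have [eps eps_gt0 psd_eps] := psdmx_unit_coercive psd_mu unitB.
  have : mu + eps <= mu.
    apply: ub_le_sup => //.
    by rewrite /S /= raddfD /= opprD addrA.
  by rewrite gerDl leNgt eps_gt0.
have mu_lb : lbound [set a | eigenvalue M a]%classic mu.
  move=> a /eigenvalueP[v vM v_neq0].
  have vv_gt0 : 0 < dotv v^T v^T.
    by rewrite lt_neqAle dotvv_ge0 eq_sym dotvv_eq0 trmx_eq0 v_neq0.
  rewrite -(ler_pM2r vv_gt0).
  have [_ /(_ v^T)] := psd_mu; rewrite qB subr_ge0 => /le_trans; apply.
  by rewrite quadformE -{1}symM -trmx_mul vM linearZ dotvZr.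
suff -> : lambda_min M = mu by [].
apply/eqP; rewrite eq_le; apply/andP; split.
  by apply: ge_inf => //; exists mu.
by apply: lb_le_inf => //; exists mu.
Qed.

End SmallestEigenvalue.

(** * Comparison of the two problems *)

Section Relaxation.
Variable R : realType.
Variables (m n p k : nat) (Q : 'M[R]_n) (q : 'cV[R]_n).
Variables (A : 'M[R]_(m, n)) (b : 'cV[R]_m) (C : 'M[R]_(p, n)) (d : 'cV[R]_p).
Variables (l u : 'cV[R]_n) (Z : 'M[R]_(n, k)).

Definition boxgap (x : 'cV[R]_n) : R :=
  dotv x x - dotv (l + u) x + dotv l u.

Lemma boxgap_le0 (x : 'cV[R]_n) : (forall i, l i 0 <= x i 0 <= u i 0) -> boxgap x <= 0.
Proof.
move=> box.
have -> : boxgap x = \sum_i (x i 0 - l i 0) * (x i 0 - u i 0).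
  rewrite /boxgap !dotvE -sumrB -big_split /=; apply: eq_bigr => i _.
  by rewrite mxE; ring.
by apply: sumr_le0 => i _; have /andP[? ?] := box i; nra.
Qed.

Lemma eigz_objE alpha x :
  eigz_obj Q q l u alpha x = quadform Q x + dotv q x + alpha * boxgap x.
Proof.
rewrite /eigz_obj quadformD quadformZ quadform_scalar mul1r.
by rewrite dotvDl dotvNl dotvZl /boxgap; ring.
Qed.

Lemma gram_lift x P : A *m x = b ->
  mxinner (A^T *m A) (x *m x^T + P) - dotv (2 *: (A^T *m b)) x + dotv b b
  = mxinner (A^T *m A) P.
Proof.
move=> Axb; rewrite mxinnerDr mxinner_dyad -[X in X *m A]mulmx1.
rewrite quadform_conj quadform_scalar dotvZl -dotv_mulmxr Axb.
by rewrite mulmx1; ring.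
Qed.

Lemma boxgap_lift x P :
  mxinner 1%:M (x *m x^T + P) - dotv (l + u) x + dotv l u = boxgap x + \tr P.
Proof.
rewrite mxinnerDr mxinner_dyad quadform_scalar mxinner1 /boxgap; ring.
Qed.

Hypothesis Zbasis : orthonormal_nullspace_basis A Z.

(** [Z *m Z^T] is the orthogonal projection onto the nullspace of [A], which
    contains the range of [P]. *)
Lemma nullspace_compression P : P^T = P -> P *m A^T = 0 ->
  P = Z *m (Z^T *m P *m Z) *m Z^T.
Proof.
case: Zbasis => ZZ ZA symP PA.
have /submxP[D PE] : (P <= Z^T)%MS.
  by rewrite (eqmxP ZA) sub_kermx PA.
have PZZ : P *m Z *m Z^T = P by rewrite PE -(mulmxA D) ZZ mulmx1.
have ZZP : Z *m Z^T *m P = P.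
  by apply: trmx_inj; rewrite !trmx_mul trmxK symP mulmxA.
by rewrite !mulmxA ZZP PZZ.
Qed.

Lemma nullspace_basis_ker : A *m Z = 0.
Proof.
case: Zbasis => _ /eqmxP ZA; apply: trmx_inj; rewrite trmx_mul trmx0.
by apply/eqP; rewrite -sub_kermx -ZA.
Qed.

Lemma eigz_le_sdp alpha x X :
  psdmx (Z^T *m Q *m Z + alpha%:M) ->
  0 <= alpha -> sdp_eigz_feasible A b C d l u (x, X) ->
  eigz_obj Q q l u alpha x <= mxinner Q X + dotv q x.
Proof.
move=> psdM alpha0 [[Axb _ _] _ psdP].
have {X psdP} [P -> psdP] : exists2 P, X = x *m x^T + P & psdmx P.
  by exists (X - x *m x^T) => //; rewrite addrC subrK.
rewrite boxgap_lift gram_lift // => gap AP0.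
have PA := psdmx_gram_orthogonal psdP AP0.
have PE := nullspace_compression (psdmx_sym psdP) PA.
have : 0 <= mxinner (Q + alpha%:M) P.
  rewrite PE mxinner_conj mulmxDr mulmxDl mul_mx_scalar -scalemxAl.
  case: Zbasis => -> _; rewrite scalemx1.
  by apply: mxinner_psdmx_ge0 => //; apply: psdmx_conj.
rewrite mxinnerDl mxinner_scalar eigz_objE mxinnerDr mxinner_dyad => QP.
by nra.
Qed.

(** The direction [Z *m w] keeps [A] out of the picture and carries the curvature
    [lam] of the form [Q]; the multiple [t] is the one that makes the trace
    constraint tight. *)
Lemma eigz_attained_sdp lam x :
  eigenvalue (Z^T *m Q *m Z) lam -> (Z^T *m Q *m Z)^T = Z^T *m Q *m Z ->
  polyX A b C d l u x ->
  exists2 X, sdp_eigz_feasible A b C d l u (x, X)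
    & mxinner Q X + dotv q x = eigz_obj Q q l u (- lam) x.
Proof.
move=> /eigenvalueP[v vM v_neq0] symM Xx; have [Axb _ box] := Xx.
pose w := v^T; have w_neq0 : dotv w w != 0 by rewrite dotvv_eq0 trmx_eq0.
have Mw : Z^T *m Q *m Z *m w = lam *: w.
  by rewrite -symM -trmx_mul vM linearZ.
pose t := - boxgap x / dotv w w.
have t0 : 0 <= t by rewrite divr_ge0 ?dotvv_ge0 // oppr_ge0 boxgap_le0.
have tww : t * dotv w w = - boxgap x by rewrite divfK.
pose P := t *: (Z *m w *m (Z *m w)^T).
have psdP : psdmx P by exact/psdmxZ/psdmx_dyad.
have trP : \tr P = - boxgap x.
  rewrite -mxinner1 mxinnerZr mxinner_dyad -quadform_conj mulmx1.
  by case: Zbasis => -> _; rewrite quadform_scalar mul1r.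
have QP : mxinner Q P = - lam * boxgap x.
  rewrite mxinnerZr mxinner_dyad -quadform_conj quadformE Mw dotvZr mulrCA tww.
  by ring.
have AP : mxinner (A^T *m A) P = 0.
  rewrite mxinnerZr mxinner_dyad -[X in X *m A]mulmx1 quadform_conj.
  by rewrite mulmxA nullspace_basis_ker mul0mx quadform0 mulr0.
exists (x *m x^T + P); last by rewrite eigz_objE mxinnerDr mxinner_dyad QP; ring.
split => //.
- apply/symmetricmxP; rewrite linearD /= trmx_mul trmxK.
  by rewrite (psdmx_sym psdP).
- by rewrite addrC addKr.
- by rewrite boxgap_lift trP subrr.
- by rewrite gram_lift.
Qed.

End Relaxation.

Theorem proposition9 (R : realType) (m n p k : nat)
    (Q : 'M[R]_n) (q : 'cV[R]_n)
    (A : 'M[R]_(m, n)) (b : 'cV[R]_m) (C : 'M[R]_(p, n)) (d : 'cV[R]_p)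
    (l u : 'cV[R]_n) (Z : 'M[R]_(n, k))
    (Qsym : Q \is symmetricmx)
    (ltlu : forall i, l i 0 < u i 0)
    (Zbasis : orthonormal_nullspace_basis A Z)
    (indef : indefinitemx (Z^T *m Q *m Z))
    (alpha_z : R) (alpha_z_ge0 : 0 <= alpha_z) :
  (- lambda_min (Z^T *m Q *m Z) <= alpha_z ->
     (mu_EIGZ Q q A b C d l u alpha_z <= mu_SDP_EIGZ Q q A b C d l u)%E) /\
  (alpha_z = - lambda_min (Z^T *m Q *m Z) ->
     mu_EIGZ Q q A b C d l u alpha_z = mu_SDP_EIGZ Q q A b C d l u).
Proof.
case: indef => /symmetricmxP symM not_psdM _.
have k_gt0 : (0 < k)%N.
  case: posnP => // k0; case: not_psdM; apply: psdmx_intro => // x.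
  (* In dimension zero every matrix is positive semidefinite. *)
  have -> : x = 0 by apply/matrixP => i; have := ltn_ord i; rewrite {2}k0.
  by rewrite quadform0.
have [psd_lam eig_lam] := lambda_minP k_gt0 symM.
have lower : - lambda_min (Z^T *m Q *m Z) <= alpha_z ->
    (mu_EIGZ Q q A b C d l u alpha_z <= mu_SDP_EIGZ Q q A b C d l u)%E.
  move=> le_alpha; apply: le_ereal_inf_tmp => _ [[x X] feas <-] /=.
  apply: (@le_trans _ _ (eigz_obj Q q l u alpha_z x)%:E).
    by apply: ereal_inf_lbound; exists x => //; case: feas.
  rewrite lee_fin; apply: (eigz_le_sdp q Zbasis _ alpha_z_ge0 feas).
  apply: psdmx_intro => [|y].
    by rewrite linearD /= tr_scalar_mx symM.
  have [_ /(_ y)] := psd_lam.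
  rewrite !quadformD quadformN !quadform_scalar.
  by have := dotvv_ge0 y; nra.
split=> // alphaE; apply/eqP; rewrite eq_le lower ?alphaE //=.
apply: le_ereal_inf_tmp => _ [x Xx <-].
have [X feas <-] := eigz_attained_sdp q Zbasis eig_lam symM Xx.
by apply: ereal_inf_lbound; exists (x, X).
Qed.
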